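(* Consider an influence diagram (possibly with several decisions) with utility node $U$ and evidence $\mathbf{e}$ with $P(\mathbf{e})>0$, and let $X\notin\mathbf{E}\cup\{U\}$ be an uncertain variable that is not affected by any decision. If, for every possible value $x$ of $X$, one sweeps upward through a decision circuit for the diagram with the evidence $\mathbf{e},\,U=1,\,x$, obtaining the root value $g(U=1,x,\mathbf{e})$, then the maximal expected utility with perfect information on $X$ (observed before the first decision is made) is $$MEU^{PI}=\frac{1}{P(\mathbf{e})}\sum_x g(U=1,x,\mathbf{e}).$$
   Context: **Influence diagram.** A directed acyclic graph of finitely many finite-valued variables: decision variables $D_1,\dots,D_n$ (totally ordered), uncertain variables with conditional probability tables given their parents, and a single binary utility variable $U$ without children, with values $1$ and $0$. No-forgetting holds: each decision's parents (the variables observed before it) include all earlier decisions and their parents. A strategy $s$ chooses an alternative for each decision in each scenario of its parents; it induces a joint distribution $P_s$ on all variables. The decision maker chooses a strategy to maximize the probability that $U=1$ given the evidence; this maximum is the maximal expected utility. Evidence $\mathbf{e}$ is an observed instantiation of a set $\mathbf{E}$ of uncertain variables, $U\notin\mathbf{E}$, none of which is affected by any decision, so $P_s(\mathbf{e})=P(\mathbf{e})$ for all $s$. ''$X$ is not affected by any decision'' means $X$ is not a descendant of any decision, so $P_s(x\mid\mathbf{e})=P(x\mid\mathbf{e})$ for all $s$. **Perfect information.** $MEU^{PI}$ is the maximal expected utility given $\mathbf{e}$ when, in addition, $X$ is observed before the first decision (so that every decision may also depend on $x$): $MEU^{PI}=\sum_x P(x\mid\mathbf{e})\max_s P_s(U=1\mid\mathbf{e},x)$,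 terms with $P(x\mid\mathbf{e})=0$ being $0$. **Decision circuit.** A rooted directed acyclic graph with sum, product and maximization nodes which computes at its root the dynamic programming function $g$ of the diagram. Let $\mathbf{I}_0$ be the set of uncertain variables observed before $D_1$, $\mathbf{I}_j$ those observed after $D_j$ and before $D_{j+1}$, and $\mathbf{I}_n$ those (together with $U$) not observed before any decision. An upward sweep with evidence $\mathbf{w}$ (an instantiation of some variables) gives $$g(\mathbf{w})=\sum_{\mathbf{I}_0}\max_{d_1}\sum_{\mathbf{I}_1}\max_{d_2}\cdots\max_{d_n}\sum_{\mathbf{I}_n}\ \prod_{Y}\lambda_y\,P(y\mid\mathbf{pa}(Y)),$$ the product being over all uncertain variables $Y$ and $U$, where $\lambda_y=0$ if $\mathbf{w}$ assigns $Y$ a value other than $y$ and $\lambda_y=1$ otherwise. *)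

(* Defs.v *)
(* MathComp world. *)
From mathcomp Require Import all_boot all_order all_algebra.

Set Implicit Arguments.
Unset Strict Implicit.
Unset Printing Implicit Defensive.

Import Order.TTheory GRing.Theory Num.Theory.
Local Open Scope ring_scope.

(* Iterated maximum.  It is only applied to nonnegative quantities over
   nonempty ranges, where starting from 0 is harmless. *)
Definition bigmaxr (R : realFieldType) (I : Type) (r : seq I) (F : I -> R) : R :=
  \big[Num.max/0]_(i <- r) F i.

(* In a finite directed graph given by its edge relation: no edge u -> v
   admits a directed path back from v to u. *)
Definition acyclic (V : finType) (edge : rel V) : Prop :=
  forall u v : V, edge u v -> ~~ connect edge v u.

Definition scenario (V : finType) (T : V -> finType) (S : {set V}) : finType :=
  {dffun forall v : {v : V | v \in S}, T (sval v)}.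

Definition assignment (V : finType) (T : V -> finType) : finType :=
  {dffun forall v : V, T v}.

Definition restrict (V : finType) (T : V -> finType) (S : {set V})
    (a : assignment T) : scenario T S :=
  finfun (fun v : {v : V | v \in S} => a (sval v)).

(* Variables of an influence diagram: inl i is the i-th decision (counted from
   0, so 'I_n carries the total order of the decisions), inr (Some c) is the
   uncertain variable c, and inr None is the utility variable U. *)
Definition idvar (n : nat) (C : finType) : finType := ('I_n + option C)%type.

(* U is binary: true is its value 1 and false its value 0. *)
Definition iddom (n : nat) (C : finType) (alt : 'I_n -> finType)
    (out : C -> finType) (v : idvar n C) : finType :=
  match v with
  | inl i => alt i
  | inr (Some c) => out c
  | inr None => bool
  end.

Record diagram (R : realFieldType) := Diagram {
  ndec : nat;
  chance : finType;
  alt : 'I_ndec -> finType;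
  out : chance -> finType;
  dom_gt0 : forall v : idvar ndec chance, (0 < #|iddom alt out v|)%N;
  pa : idvar ndec chance -> {set idvar ndec chance};
  pa_acyclic : acyclic [rel u v | u \in pa v];
  util_childless : forall v, inr None \notin pa v;
  no_forgetting : forall i j : 'I_ndec, (i < j)%N ->
    inl i \in pa (inl j) /\ pa (inl i) \subset pa (inl j);
  cpt : forall Y : option chance,
    scenario (iddom alt out) (pa (inr Y)) -> iddom alt out (inr Y) -> R;
  cpt_ge0 : forall Y sc y, 0 <= cpt (Y := Y) sc y;
  cpt_sum1 : forall Y sc, \sum_y cpt (Y := Y) sc y = 1
}.
Arguments cpt {R} d Y sc y.
Arguments pa {R} d v.

Definition var (R : realFieldType) (G : diagram R) : finType :=
  idvar (ndec G) (chance G).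

(* Uncertain variables together with U, which is None. *)
Definition uvar (R : realFieldType) (G : diagram R) : finType :=
  option (chance G).

Definition dom (R : realFieldType) (G : diagram R) (v : var G) : finType :=
  iddom (@alt R G) (@out R G) v.

Definition udom (R : realFieldType) (G : diagram R) (Y : uvar G) : finType :=
  dom (inr Y : var G).

Definition asg (R : realFieldType) (G : diagram R) : finType :=
  assignment (@dom R G).

Definition arc (R : realFieldType) (G : diagram R) : rel (var G) :=
  [rel u v | u \in pa G v].

Definition affected (R : realFieldType) (G : diagram R) (Y : uvar G) : bool :=
  [exists i : 'I_(ndec G), connect (@arc R G) (inl i) (inr Y)].

Definition strategy (R : realFieldType) (G : diagram R) : finType :=
  {dffun forall i : 'I_(ndec G),
     {ffun scenario (@dom R G) (pa G (inl i)) -> dom (inl i : var G)}}.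

Definition cpts (R : realFieldType) (G : diagram R) (Y : uvar G) (a : asg G) : R :=
  cpt G Y (restrict (pa G (inr Y)) a) (a (inr Y)).

(* The joint distribution P_s. *)
Definition joint (R : realFieldType) (G : diagram R) (s : strategy G)
    (a : asg G) : R :=
  (\prod_(Y : uvar G) cpts Y a) *
  \prod_(i : 'I_(ndec G)) (s i (restrict (pa G (inl i)) a) == a (inl i))%:R.

(* An instantiation of some of the uncertain variables and U. *)
Definition evidence (R : realFieldType) (G : diagram R) : Type :=
  forall Y : uvar G, option (udom Y).

Definition extend (R : realFieldType) (G : diagram R) (w : evidence G)
    (Y : uvar G) (y : udom Y) : evidence G :=
  dfwith w (Some y).

Definition compatible (R : realFieldType) (G : diagram R) (w : evidence G)
    (Y : uvar G) (y : udom Y) : bool :=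
  if w Y is Some y' then y == y' else true.

Definition lambda (R : realFieldType) (G : diagram R) (w : evidence G)
    (Y : uvar G) (y : udom Y) : R :=
  (compatible w y)%:R.

Definition Pr (R : realFieldType) (G : diagram R) (s : strategy G)
    (w : evidence G) : R :=
  \sum_(a : asg G | [forall Y : uvar G, compatible w (a (inr Y))]) joint s a.

(* P_s(Y = y | w), with the convention that it is 0 when P_s(w) = 0. *)
Definition condPr (R : realFieldType) (G : diagram R) (s : strategy G)
    (Y : uvar G) (y : udom Y) (w : evidence G) : R :=
  Pr s (extend w y) / Pr s w.

(* MEU^PI.  P(x | e) does not depend on the strategy when X and the observed
   variables are unaffected; it is read off from a reference strategy s0. *)
Definition MEU_PI (R : realFieldType) (G : diagram R) (s0 : strategy G)
    (e : evidence G) (X : chance G) : R :=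
  \sum_(x : udom (Some X : uvar G))
     condPr s0 x e *
     bigmaxr (enum (strategy G)) (fun s : strategy G =>
       condPr s (true : udom (None : uvar G)) (extend e x)).

(* The set I_j: by no-forgetting a variable observed before some decision is
   observed before all later ones, and since inl i is the decision D_(i+1),
   observed after D_j and before D_(j+1) means: parent of inl i exactly when
   j <= i.  For j = ndec this leaves the variables that are never observed. *)
Definition stage (R : realFieldType) (G : diagram R) (j : nat) : {set var G} :=
  [set v : var G | if v is inr _ then
     [forall i : 'I_(ndec G), (v \in pa G (inl i)) == (j <= i)%N] else false].

Definition agree_off (R : realFieldType) (G : diagram R) (S : {set var G})
    (a b : asg G) : bool :=
  [forall v : var G, (v \notin S) ==> (b v == a v)].

(* sum_out S F a and max_out S F a let the variables of S range over their
   values, the other variables being fixed by a. *)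
Definition sum_out (R : realFieldType) (G : diagram R) (S : {set var G})
    (F : asg G -> R) (a : asg G) : R :=
  \sum_(b : asg G | agree_off S a b) F b.

Definition max_out (R : realFieldType) (G : diagram R) (S : {set var G})
    (F : asg G -> R) (a : asg G) : R :=
  bigmaxr [seq b <- enum (asg G) | agree_off S a b] F.

Definition dflt (R : realFieldType) (G : diagram R) : asg G :=
  finfun (fun v : var G => enum_val (Ordinal (@dom_gt0 R G v)) : dom v).

(* The dynamic programming function
     g(w) = \sum_(I_0) max_(d_1) \sum_(I_1) ... max_(d_n) \sum_(I_n)
              \prod_Y lambda_y P(y | pa(Y)).
   Every variable is bound by one of the operators, so the base assignment
   dflt plays no role. *)
Definition dpfun (R : realFieldType) (G : diagram R) (w : evidence G) : R :=
  foldr (fun (i : 'I_(ndec G)) F =>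
           sum_out (stage G i) (max_out [set (inl i : var G)] F))
        (sum_out (stage G (ndec G)) (fun a : asg G =>
           \prod_(Y : uvar G) (lambda w (a (inr Y)) * cpts Y a)))
        (enum 'I_(ndec G)) (dflt G).

(* The leaves are the evidence indicators lambda_y and the parameters
   P(y | pa(Y)). *)
Inductive gate (R : realFieldType) (G : diagram R) (N : Type) : Type :=
| Indicator (Y : uvar G) (y : udom Y)
| Theta (Y : uvar G) (sc : scenario (@dom R G) (pa G (inr Y))) (y : udom Y)
| Sum of seq N
| Prod of seq N
| Max of seq N.

Definition children (R : realFieldType) (G : diagram R) (N : Type)
    (k : gate G N) : seq N :=
  match k with
  | Indicator _ _ | Theta _ _ _ => [::]
  | Sum cs | Prod cs | Max cs => cs
  end.

Record circuit (R : realFieldType) (G : diagram R) := Circuit {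
  node : finType;
  root : node;
  gate_of : node -> gate G node;
  circuit_acyclic : acyclic [rel u v | v \in children (gate_of u)];
  circuit_rooted : forall v : node,
    connect [rel u v | v \in children (gate_of u)] root v;
  circuit_inner : forall v : node,
    match gate_of v with
    | Sum cs | Prod cs | Max cs => (0 < size cs)%N
    | _ => true
    end
}.

Definition gate_value (R : realFieldType) (G : diagram R) (N : Type)
    (w : evidence G) (nu : N -> R) (k : gate G N) : R :=
  match k with
  | Indicator _ y => lambda w y
  | Theta Y sc y => cpt G Y sc y
  | Sum cs => \sum_(c <- cs) nu c
  | Prod cs => \prod_(c <- cs) nu c
  | Max cs => bigmaxr cs nu
  end.

(* Upward sweep: after k rounds every node all of whose downward paths have
   fewer than k edges carries its value; by acyclicity #|node| rounds
   evaluate the whole circuit. *)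
Definition sweep (R : realFieldType) (G : diagram R) (D : circuit G)
    (w : evidence G) : node D -> R :=
  iter #|node D| (fun nu v => gate_value w nu (gate_of v)) (fun=> 0).

Definition root_value (R : realFieldType) (G : diagram R) (D : circuit G)
    (w : evidence G) : R :=
  sweep w (root D).

Definition decision_circuit (R : realFieldType) (G : diagram R)
    (D : circuit G) : Prop :=
  forall w : evidence G, root_value D w = dpfun w.

(* Main.v *)
(* For every instantiation w, the dynamic programming function is
   g(w) = max_s P_s(w), whether or not the instantiated variables are observed:
   by no-forgetting, the variables bound outside max_(d_i) are exactly the
   parents of D_i, so a choice of maximizers is a strategy.  The joint
   probability of e and x is the same under every strategy, so dividing
   P_s(U = 1, x, e) by it commutes with the maximum; the factor P(x | e)
   cancels it up to 1 / P(e), and if P(x, e) = 0 both sides vanish. *)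
Require Import Defs.
From mathcomp Require Import all_boot all_order all_algebra.

Set Implicit Arguments.
Unset Strict Implicit.
Unset Printing Implicit Defensive.

Import Order.TTheory GRing.Theory Num.Theory.
Local Open Scope ring_scope.

(** * Maxima over finite sequences *)

Lemma le_bigmaxr (R : realFieldType) (I : eqType) (r : seq I) (F : I -> R)
    (x : I) :
  x \in r -> F x <= bigmaxr r F.
Proof. by move=> xr; apply: le_bigmax_seq. Qed.

(** The sign condition on [F x] is there because [bigmaxr] starts from 0. *)
Lemma bigmaxr_attained (R : realFieldType) (I : eqType) (r : seq I) (F : I -> R)
    (x : I) :
  x \in r -> 0 <= F x -> {in r, forall y, F y <= F x} -> bigmaxr r F = F x.
Proof.
move=> xr Fx0 Fmax; apply/eqP; rewrite eq_le; apply/andP; split.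
  rewrite /bigmaxr big_seq; elim/big_ind: _ => // u v hu hv.
  by rewrite ge_max hu hv.
exact: le_bigmaxr.
Qed.

(** * Summing and maximizing over sets of variables *)

Section Summation.
Variables (R : realFieldType) (G : diagram R).
Implicit Types (S T : {set var G}) (F H : asg G -> R) (a b c : asg G).

Lemma agree_offP S a b :
  reflect (forall v, v \notin S -> b v = a v) (agree_off S a b).
Proof.
apply: (iffP forallP) => h v; first by move=> vS; apply/eqP; apply: (implyP (h v)).
by apply/implyP => vS; apply/eqP; apply: h.
Qed.

(** Semantic form of [F] not depending on the variables in [S]; such an [F] can be pulled out of a
    sum over [S]. *)
Definition constant_on S F : Prop := forall a b, agree_off S a b -> F b = F a.

Lemma restrict_agree S T a b :
  [disjoint S & T] -> agree_off T a b ->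
  restrict S b = restrict S a.
Proof.
move=> dST /agree_offP ab; apply/ffunP => -[v vS]; rewrite !ffunE /=.
by apply: ab; rewrite (disjointFr dST vS).
Qed.

Lemma eq_restrict S a b :
  restrict S b = restrict S a -> agree_off (~: S) a b.
Proof.
move=> /ffunP ab; apply/agree_offP => v; rewrite inE negbK => vS.
by have := ab (exist _ v vS); rewrite !ffunE.
Qed.

Lemma eq_sum_out S F H a :
  (forall b, F b = H b) -> sum_out S F a = sum_out S H a.
Proof. by move=> FH; apply: eq_bigr => b _. Qed.

Lemma sum_out_const S F : constant_on S (sum_out S F).
Proof.
move=> a b /agree_offP ab; apply: eq_bigl => c.
by apply/agree_offP/agree_offP => h v vS; rewrite (h v vS) (ab v vS).
Qed.

Lemma sum_outM S F H a : constant_on S H ->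
  sum_out S (fun b => H b * F b) a = H a * sum_out S F a.
Proof. by move=> cH; rewrite /sum_out big_distrr; apply: eq_bigr => b /cH ->. Qed.

Lemma sum_outT F a : sum_out setT F a = \sum_b F b.
Proof. by apply: eq_bigl => b; apply/agree_offP => v; rewrite inE. Qed.

Lemma sum_outU S T F a : [disjoint S & T] ->
  sum_out (S :|: T) F a = sum_out S (sum_out T F) a.
Proof.
move=> dST; rewrite /sum_out.
rewrite [RHS](exchange_big_dep (agree_off (S :|: T) a)) /=; last first.
  move=> b c /agree_offP ab /agree_offP bc; apply/agree_offP => v.
  by rewrite inE negb_or => /andP[vS vT]; rewrite bc // ab.
apply: eq_bigr => c /agree_offP ac.
(* The only assignment between [a] and [c]: the variables of [T] still have their values from [a],
   all others already have those of [c]. *)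
pose b : asg G := finfun (fun v => if v \in T then a v else c v).
rewrite (big_pred1 b) // => b'.
apply/andP/eqP => [[/agree_offP ab /agree_offP bc]|->].
  apply/ffunP => v; rewrite ffunE; case: ifP => vT; last by rewrite bc ?vT.
  by rewrite ab // (disjointFl dST vT).
split; apply/agree_offP => v vS; rewrite ffunE; last by rewrite (negPf vS).
by case: ifP => // vT; rewrite ac // inE negb_or vS vT.
Qed.

Definition upd a (v : var G) (y : dom v) : asg G := finfun (dfwith a y).

Lemma upd_in a (v : var G) (y : dom v) : upd a y v = y.
Proof. by rewrite ffunE dfwith_in. Qed.

Lemma agree_upd a (v : var G) (y : dom v) : agree_off [set v] a (upd a y).
Proof.
by apply/agree_offP => u; rewrite inE => uv; rewrite ffunE dfwith_out // eq_sym.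
Qed.

Lemma agree1_upd a b (v : var G) : agree_off [set v] a b -> b = upd a (b v).
Proof.
move=> /agree_offP ab; apply/ffunP => u.
have [->|uv] := eqVneq u v; first by rewrite upd_in.
by rewrite ab ?inE // ffunE dfwith_out // eq_sym.
Qed.

Lemma sum_out1 (v : var G) F a :
  sum_out [set v] F a = \sum_(y : dom v) F (upd a y).
Proof.
rewrite /sum_out (reindex_onto (fun y => upd a y) (fun b => b v)) /=; last first.
  by move=> b /agree1_upd <-.
by apply: eq_bigl => y; rewrite agree_upd upd_in eqxx.
Qed.

Lemma max_out_const S F : constant_on S (max_out S F).
Proof.
move=> a b /agree_offP ab; rewrite /max_out; congr bigmaxr; apply: eq_filter => c.
by apply/agree_offP/agree_offP => h v vS; rewrite (h v vS) (ab v vS).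
Qed.

Lemma le_max_out S F a b : agree_off S a b -> F b <= max_out S F a.
Proof. by move=> ab; apply: le_bigmaxr; rewrite mem_filter ab; apply: mem_enum. Qed.

Lemma max_out_attained S F a : (forall b, 0 <= F b) ->
  exists2 b, agree_off S a b & max_out S F a = F b.
Proof.
move=> F0; have aa : agree_off S a a by apply/agree_offP.
case: (@arg_maxP _ R _ a (agree_off S a) F aa) => b ab bmax.
exists b => //; apply: bigmaxr_attained => //.
  by rewrite mem_filter ab mem_enum.
by move=> c; rewrite mem_filter => /andP[ac _]; apply: bmax.
Qed.

End Summation.

(** * Factorization and marginals of the joint distribution *)

Section Marginals.
Variables (R : realFieldType) (G : diagram R).
Implicit Types (S : {set var G}) (s : strategy G) (a b : asg G) (w : evidence G).

Definition obeys s (i : 'I_(ndec G)) a : R :=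
  (s i (restrict (pa G (inl i)) a) == a (inl i))%:R.

(** A strategy acts as a deterministic conditional table for each decision, so that a diagram with a
    fixed strategy becomes a Bayesian network. *)
Definition factor s (v : var G) a : R :=
  match v with inl i => obeys s i a | inr Y => cpts Y a end.

Lemma joint_factor s a : joint s a = \prod_v factor s v a.
Proof. by rewrite big_sumType /= mulrC. Qed.

Lemma pa_irr (v : var G) : v \notin pa G v.
Proof. by apply/negP => vv; have := pa_acyclic vv; rewrite connect0. Qed.

Lemma cpts_ge0 (Y : uvar G) a : 0 <= cpts Y a.
Proof. exact: cpt_ge0. Qed.

Lemma joint_ge0 s a : 0 <= joint s a.
Proof. by rewrite mulr_ge0 // prodr_ge0 // => *; rewrite ?cpts_ge0 ?ler0n. Qed.

Lemma obeys_const s i S :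
  inl i \notin S -> [disjoint pa G (inl i) & S] -> constant_on S (obeys s i).
Proof.
move=> iS dS a b ab; rewrite /obeys (restrict_agree dS ab).
by move/agree_offP: ab => ->.
Qed.

Lemma factor_const s v S :
  v \notin S -> [disjoint pa G v & S] -> constant_on S (factor s v).
Proof.
case: v => [i|Y] vS dS; first exact: obeys_const.
move=> a b ab; rewrite /= /cpts (restrict_agree dS ab).
by move/agree_offP: ab => ->.
Qed.

Lemma restrict_upd (v : var G) a (y : dom v) :
  restrict (pa G v) (upd a y) = restrict (pa G v) a.
Proof.
by apply: restrict_agree (agree_upd a y); rewrite disjoint_sym disjoints1 pa_irr.
Qed.

(** The weight [obeys] is a point mass at the prescribed alternative: a decision is not its own
    parent, so changing it leaves its scenario intact. *)
Lemma sum_out_obeys s i (F : asg G -> R) a :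
  sum_out [set (inl i : var G)] (fun b => obeys s i b * F b) a =
  F (upd a (s i (restrict (pa G (inl i)) a) : dom (inl i : var G))).
Proof.
rewrite sum_out1 (bigD1 (s i (restrict (pa G (inl i)) a) : dom (inl i : var G))) //=.
rewrite /obeys restrict_upd upd_in eqxx mul1r big1 ?addr0 // => y ny.
by rewrite restrict_upd upd_in eq_sym (negPf ny) mul0r.
Qed.

Lemma sum_out_factor s (v : var G) a : sum_out [set v] (factor s v) a = 1.
Proof.
case: v => [i|Y].
  rewrite -[RHS](sum_out_obeys s i (fun=> 1) a).
  by apply: eq_sum_out => b; rewrite mulr1.
rewrite sum_out1 -[RHS](cpt_sum1 (restrict (pa G (inr Y)) a)).
by apply: eq_bigr => y _; rewrite /= /cpts restrict_upd upd_in.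
Qed.

(** Take a variable outside [S] with the fewest ancestors; by acyclicity, a parent of it outside [S]
    would have strictly fewer. *)
Lemma exists_source S : S != setT -> exists2 v, v \notin S & pa G v \subset S.
Proof.
move=> ST; have [v0 v0S] : exists v, v \notin S.
  apply/existsP; apply: contraNT ST; rewrite negb_exists => /forallP h.
  by apply/eqP/setP => v; rewrite inE; apply/negPn.
pose anc (v : var G) := #|[set u | connect (@Defs.arc R G) u v]|.
case: (@arg_minnP _ v0 (fun v => v \notin S) anc v0S) => v vS vmin.
exists v => //; apply/subsetP => u uv; apply/negPn/negP => uS.
have := vmin u uS; rewrite leqNgt => /negP; apply; apply: proper_card.
apply/properP; split; last first.
  by exists v; rewrite inE ?connect0 //; apply: pa_acyclic.
apply/subsetP => t; rewrite !inE => tu; apply: connect_trans tu _.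
exact: connect1.
Qed.

(** Induction on the number of variables outside [S]. Peel off a [v] with all parents in [S]; after
    the rest is summed out, the factor of [v] sums to 1, and no factor of [S] reads [v] because [S]
    is closed under parents. *)
Lemma sum_out_joint s S a : (forall v, v \in S -> pa G v \subset S) ->
  sum_out (~: S) (joint s) a = \prod_(v in S) factor s v a.
Proof.
elim: {S}_.+1 {-2}S (ltnSn #|~: S|) a => // m IH S leS a closedS.
have [ST|ST] := eqVneq S setT.
  rewrite ST setCT /sum_out (big_pred1 a) => [|b].
    by rewrite joint_factor; apply: eq_bigl => v; rewrite inE.
  by apply/agree_offP/eqP => [h|-> //]; apply/ffunP => v; apply: h; rewrite inE.
have [v vS pvS] := exists_source ST.
have eqS : ~: S = [set v] :|: ~: (v |: S).
  apply/setP => u; rewrite !inE; case: eqVneq => //= ->; by rewrite vS.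
have dv : [disjoint [set v] & ~: (v |: S)] by rewrite disjoints1 !inE eqxx.
rewrite eqS sum_outU //.
under eq_sum_out => b.
  rewrite IH; first (rewrite big_setU1 //= mulrC; over).
    rewrite -ltnS; apply: leq_trans leS; rewrite eqS cardsU disjoint_setI0 //.
    by rewrite cards0 cards1 subn0.
  move=> u; rewrite !inE => /orP[/eqP->|uS].
    exact: subset_trans pvS (subsetUr _ _).
  exact: subset_trans (closedS u uS) (subsetUr _ _).
rewrite sum_outM ?sum_out_factor ?mulr1 // => b c bc.
apply: eq_bigr => u uS; apply: factor_const bc.
  by rewrite inE; apply: contraNneq vS => <-.
by rewrite disjoint_sym disjoints1; apply: contra vS; apply/subsetP/closedS.
Qed.

(** * Probabilities of evidence *)

Definition agrees w a : bool := [forall Y : uvar G, compatible w (a (inr Y))].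

Lemma Pr_sum_out s w a0 :
  Pr s w = sum_out setT (fun a => (agrees w a)%:R * joint s a) a0.
Proof.
rewrite sum_outT /Pr big_mkcond; apply: eq_bigr => a _.
by rewrite /agrees; case: ifP; rewrite ?mul1r ?mul0r.
Qed.

Lemma Pr_ge0 s w : 0 <= Pr s w.
Proof. by apply: sumr_ge0 => a _; apply: joint_ge0. Qed.

Lemma eq_Pr s w w' : (forall Y, w Y = w' Y) -> Pr s w = Pr s w'.
Proof.
move=> ww; apply: eq_bigl => a; apply: eq_forallb => Y.
by rewrite /compatible ww.
Qed.

Lemma extend_in w Y (y : udom Y) : extend w y Y = Some y.
Proof. by rewrite /extend dfwith_in. Qed.

Lemma extend_out w Y (y : udom Y) Z : Z != Y -> extend w y Z = w Z.
Proof. by move=> ZY; rewrite /extend dfwith_out // eq_sym. Qed.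

Lemma extendC w Y Z (y : udom Y) (z : udom Z) : Y != Z ->
  forall V, extend (extend w y) z V = extend (extend w z) y V.
Proof.
move=> YZ V; have [->|VZ] := eqVneq V Z.
  by rewrite extend_in extend_out 1?eq_sym // extend_in.
rewrite extend_out //; have [->|VY] := eqVneq V Y; first by rewrite !extend_in.
by rewrite !extend_out.
Qed.

(** As [Y] is not yet instantiated, the extension overwrites nothing and only shrinks the event. *)
Lemma le_Pr_extend s w Y (y : udom Y) : w Y = None ->
  Pr s (extend w y) <= Pr s w.
Proof.
move=> wY; rewrite /Pr [leLHS]big_mkcond [leRHS]big_mkcond; apply: ler_sum => a _.
case: ifP => [/forallP h|_]; last by case: ifP => // _; apply: joint_ge0.
rewrite ifT //; apply/forallP => Z; have [->|ZY] := eqVneq Z Y.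
  by rewrite /compatible wY.
by have := h Z; rewrite /compatible extend_out.
Qed.

(* The unaffected variables are closed under taking parents and contain no
   decision, so their marginal is a product of conditional probability tables. *)
Lemma Pr_unaffected s s' w :
  (forall Y, w Y <> None -> ~~ affected Y) -> Pr s w = Pr s' w.
Proof.
move=> w_unaff.
pose S := [set v : var G | [forall i, ~~ connect (@Defs.arc R G) (inl i) v]].
have closedS v : v \in S -> pa G v \subset S.
  rewrite inE => /forallP vS; apply/subsetP => u uv; rewrite inE.
  apply/forallP => i; apply: contra (vS i) => iu; apply: connect_trans iu _.
  exact: connect1.
have marginal t : Pr t w = sum_out S (fun a =>
    (agrees w a)%:R * \prod_(v in S) factor t v a) (dflt G).
  rewrite (Pr_sum_out t w (dflt G)) -(setUCr S) sum_outU; last first.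
    by rewrite -setI_eq0 setICr.
  apply: eq_sum_out => a; rewrite sum_outM ?sum_out_joint // => b c /agree_offP bc.
  congr (_ %:R); congr nat_of_bool; apply: eq_forallb => Y.
  rewrite /compatible; case E: (w Y) => [y|//]; rewrite bc // !inE negbK.
  by have := w_unaff Y; rewrite E /affected negb_exists; apply.
rewrite !marginal; apply: eq_sum_out => a; congr (_ * _).
apply: eq_bigr => -[i|Y] //; rewrite inE => /forallP/(_ i).
by rewrite connect0.
Qed.

End Marginals.

(** * Tails of the dynamic programming recursion *)

Section DynamicProgramming.
Variables (R : realFieldType) (G : diagram R) (w : evidence G).
Implicit Types (s : strategy G) (a b : asg G) (k : nat) (i : 'I_(ndec G)).

Definition weight a : R := \prod_(Y : uvar G) (lambda w (a (inr Y)) * cpts Y a).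

(** The recursion entered just before the sum that precedes decision [k], counted from 0; for
    [k = ndec G] only the innermost sum remains. *)
Definition dp_from k : asg G -> R :=
  foldr (fun (i : 'I_(ndec G)) F =>
           sum_out (stage G i) (max_out [set (inl i : var G)] F))
        (sum_out (stage G (ndec G)) weight)
        (drop k (enum 'I_(ndec G))).

Lemma dp_from_last : dp_from (ndec G) = sum_out (stage G (ndec G)) weight.
Proof. by rewrite /dp_from drop_oversize // size_enum_ord. Qed.

Lemma dp_from_step i : dp_from i =
  sum_out (stage G i) (max_out [set (inl i : var G)] (dp_from i.+1)).
Proof.
by rewrite /dp_from (drop_nth i) ?size_enum_ord //= nth_ord_enum.
Qed.

Lemma dp_from0 : dpfun w = dp_from 0 (dflt G).
Proof. by rewrite /dp_from drop0. Qed.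

Lemma weight_ge0 a : 0 <= weight a.
Proof. by apply: prodr_ge0 => Y _; rewrite mulr_ge0 ?ler0n ?cpts_ge0. Qed.

Lemma dp_from_ge0 k a : 0 <= dp_from k a.
Proof.
rewrite /dp_from; elim: (drop _ _) a => [|i l IH] a /=.
  by apply: sumr_ge0 => b _; apply: weight_ge0.
apply: sumr_ge0 => b _; apply: le_trans (IH b) _.
by apply: le_max_out; apply/agree_offP.
Qed.

(* The variables bound by the operators of dp_from k. *)
Definition pending k : {set var G} :=
  [set v : var G | match v with
     | inl i => k <= i
     | inr _ => [forall i : 'I_(ndec G), (v \in pa G (inl i)) ==> (k <= i)]
     end]%N.

Lemma pending0 : pending 0 = setT.
Proof.
by apply/setP => -[i|Y]; rewrite !inE //; apply/forallP => i; apply/implyP.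
Qed.

Lemma pending_last : pending (ndec G) = stage G (ndec G).
Proof.
apply/setP => -[i|Y]; rewrite !inE; first by rewrite leqNgt ltn_ord.
by apply: eq_forallb => i; rewrite leqNgt ltn_ord /=; case: (_ \in _).
Qed.

(** If [i < j], no-forgetting gives the opposite arc and hence a cycle. *)
Lemma pa_decision (i j : 'I_(ndec G)) :
  (inl j : var G) \in pa G (inl i) -> (j < i)%N.
Proof.
move=> ji; case: ltngtP => // [ij|/ord_inj ij]; last first.
  by have := pa_irr (inl i : var G); rewrite -{1}ij ji.
have [ij' _] := no_forgetting ij.
have := @pa_acyclic _ G (inl i) (inl j) ij'; rewrite connect1 //.
Qed.

Lemma pa_mono (v : var G) (i j : 'I_(ndec G)) :
  v \in pa G (inl i) -> (i <= j)%N -> v \in pa G (inl j).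
Proof.
move=> vi; rewrite leq_eqVlt => /orP[/eqP/ord_inj <- //|].
by case/no_forgetting => _ /subsetP; apply.
Qed.

(** What the tail after decision [i] may depend on is exactly this decision and its scenario. Hence
    a maximizing alternative can be chosen from the scenario alone. *)
Lemma pendingSC i : ~: pending i.+1 = inl i |: pa G (inl i).
Proof.
apply/setP => -[j|Y]; rewrite !inE.
  rewrite -leqNgt leq_eqVlt; congr (_ || _).
  apply/idP/idP => [ji|]; [by case: (no_forgetting ji)|exact: pa_decision].
rewrite /= negb_forall; apply/existsP/idP => [[j]|Yi].
  by rewrite negb_imply -ltnNge ltnS => /andP[Yj ji]; apply: pa_mono Yj ji.
by exists i; rewrite Yi ltnn.
Qed.

Lemma pending_step i :
  pending i = stage G i :|: ([set (inl i : var G)] :|: pending i.+1).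
Proof.
apply/setP => v; rewrite [in RHS]inE [v \in _ :|: pending _]inE.
rewrite -[v \in pending i.+1]negbK -in_setC pendingSC.
case: v => [j|Y]; rewrite !inE /=.
  rewrite leq_eqVlt negb_or; case: (eqVneq j i) => [->|ji]; rewrite ?eqxx //=.
  have -> : (i == j :> nat) = false by apply/negbTE; rewrite eq_sym.
  have -> : (inl j == inl i :> var G) = false by apply/negbTE.
  apply/idP/negP => [ij /pa_decision ji'|].
    by have := ltn_trans ij ji'; rewrite ltnn.
  move=> nji; case: ltngtP => // [ji'|/ord_inj E].
    by case: nji; case: (no_forgetting ji').
  by rewrite E eqxx in ji.
apply/forallP/orP => [h|[/forallP h j|nYi j]].
- case: (boolP (_ \in pa G (inl i))) => [Yi|]; [left|by right].
  apply/forallP => j; apply/eqP; apply/idP/idP; first exact: (implyP (h j)).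
  exact: (pa_mono Yi).
- by rewrite (eqP (h j)) implybb.
- apply/implyP => Yj; rewrite leqNgt; apply: contra nYi => /ltnW ji.
  exact: (pa_mono Yj ji).
Qed.

Lemma disjoint_pending i : [disjoint [set (inl i : var G)] & pending i.+1].
Proof. by rewrite disjoints1 inE ltnn. Qed.

Lemma disjoint_stage i :
  [disjoint stage G i & [set (inl i : var G)] :|: pending i.+1].
Proof.
rewrite disjoint_subset; apply/subsetP => -[j|Y]; rewrite !inE //=.
move=> /forallP/(_ i)/eqP; rewrite leqnn => Yi.
by apply/negP => /forallP/(_ i); rewrite Yi ltnn.
Qed.

(** * Values of strategies compared with the recursion *)

Definition obeys_from s k a : R := \prod_(i < ndec G | (k <= i)%N) obeys s i a.

(** Counterpart of [dp_from k] in which the decisions from [k] on follow [s] instead of being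
    maximized, written as a single sum. *)
Definition value_from s k : asg G -> R :=
  sum_out (pending k) (fun a => obeys_from s k a * weight a).

Lemma prod_lambda a : \prod_(Y : uvar G) lambda w (a (inr Y)) = (agrees w a)%:R.
Proof.
rewrite /agrees; case: (boolP [forall Y, _]) => [/forallP h|].
  by rewrite big1 // => Y _; rewrite /lambda h.
rewrite negb_forall => /existsP[Y nY].
by rewrite (bigD1 Y) //= {1}/lambda (negPf nY) mul0r.
Qed.

Lemma value_from0 s a : Pr s w = value_from s 0 a.
Proof.
rewrite (Pr_sum_out s w a) /value_from pending0; apply: eq_sum_out => b.
rewrite /obeys_from /weight big_split /= prod_lambda /joint.
by rewrite mulrA mulrC.
Qed.

Lemma value_from_last s a : value_from s (ndec G) a = dp_from (ndec G) a.
Proof.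
rewrite dp_from_last /value_from pending_last; apply: eq_sum_out => b.
by rewrite /obeys_from big_pred0 ?mul1r // => i; rewrite leqNgt ltn_ord.
Qed.

Lemma value_from_step s i a : value_from s i a =
  sum_out (stage G i) (fun b => value_from s i.+1
    (upd b (s i (restrict (pa G (inl i)) b) : dom (inl i : var G)))) a.
Proof.
rewrite {1}/value_from pending_step sum_outU ?disjoint_stage //.
apply: eq_sum_out => b; rewrite sum_outU ?disjoint_pending //.
(* The prescribed alternative is turned back into a sum over the decision weighted by [obeys]. This
   weight moves under the inner sum, since it reads only the decision and its parents, none of which
   is pending after [i]. *)
rewrite -sum_out_obeys; apply: eq_sum_out => c; rewrite -sum_outM; last first.
  apply: obeys_const; first by rewrite inE ltnn.
  rewrite disjoint_sym disjoints_subset; apply/subsetP => v.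
  rewrite -[pending _]setCK pendingSC.
  by rewrite !inE negb_or => /andP[].
apply: eq_sum_out => d; rewrite mulrA; congr (_ * _).
rewrite /obeys_from (bigD1 i) //=; congr (_ * _); apply: eq_bigl => j.
by rewrite ltn_neqAle andbC eq_sym.
Qed.

(** Backward induction, from after the last decision to the first. *)
Lemma ord_down_ind (P : nat -> Prop) : P (ndec G) ->
  (forall i, P i.+1 -> P i) -> forall k, (k <= ndec G)%N -> P k.
Proof.
move=> Pn PS k kn; rewrite -(subKn kn); elim: (_ - k)%N => [|m IH].
  by rewrite subn0.
have [mn|nm] := ltnP m (ndec G); last first.
  (* Here the truncated subtraction has already reached 0. *)
  by move: IH; rewrite (eqP nm) (eqP (leqW nm)).
have lt : (ndec G - m.+1 < ndec G)%N by rewrite ltn_subrL (leq_ltn_trans _ mn).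
by apply: (PS (Ordinal lt)); rewrite /= subnSK.
Qed.

(** At each decision, the alternative chosen by [s] is one candidate of the maximum. *)
Lemma value_from_le s k a : (k <= ndec G)%N -> value_from s k a <= dp_from k a.
Proof.
move=> kn; elim/ord_down_ind: k / kn a => [a|i IH a].
  by rewrite value_from_last.
rewrite value_from_step dp_from_step; apply: ler_sum => b _.
by apply: le_trans (IH _) _; apply: le_max_out; apply: agree_upd.
Qed.

(** A scenario fixes only the parents, so the choice goes through a full assignment that extends it
    and whose own alternative is a maximizer. The default [dflt G] only makes the term total:
    [optimal_max] shows that [pick] succeeds on the scenario of any assignment. *)
Definition optimal : strategy G :=
  finfun (fun i : 'I_(ndec G) =>
    finfun (fun sc : scenario (@dom R G) (pa G (inl i)) =>
      odflt (dflt G)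
        [pick b : asg G | (restrict (pa G (inl i)) b == sc) &&
           (dp_from i.+1 b == max_out [set (inl i : var G)] (dp_from i.+1) b)]
        (inl i : var G))).

Lemma optimal_max i a : constant_on (pending i.+1) (dp_from i.+1) ->
  dp_from i.+1
    (upd a (optimal i (restrict (pa G (inl i)) a) : dom (inl i : var G))) =
  max_out [set (inl i : var G)] (dp_from i.+1) a.
Proof.
set V := dp_from i.+1; set d : var G := inl i => cV.
(* The tail reads only the decision and its parents, so the value at [b] carries over to any [c]
   with the same scenario. *)
have same b c : restrict (pa G d) b = restrict (pa G d) c -> V (upd c (b d)) = V b.
  move=> /eq_restrict/agree_offP bc; apply: cV; apply/agree_offP => v.
  rewrite -in_setC pendingSC !inE => /orP[/eqP ->|vd]; first by rewrite upd_in.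
  have [->|nvd] := eqVneq v d; first by rewrite upd_in.
  have /agree_offP -> := agree_upd c (b d); last by rewrite inE.
  by rewrite bc // inE negbK.
have V0 : forall b, 0 <= V b := @dp_from_ge0 i.+1.
have [b ab Vb] := max_out_attained [set d] a V0.
have rb : restrict (pa G d) b = restrict (pa G d) a.
  by rewrite (agree1_upd ab) restrict_upd.
(* The maximizer [b] near [a] itself meets the condition of [pick], which excludes failure. *)
rewrite /optimal !ffunE; case: pickP => [c /andP[/eqP rc /eqP Vc]|/(_ b)];
  last first.
  by rewrite rb eqxx /= (max_out_const _ ab) Vb eqxx.
rewrite -/V in Vc.
(* The picked [c] may differ from [a] outside the scenario. The alternative of [b] is also available
   at [c], with the same value there, so the maximum at [c] is at least that at [a]. *)
apply/eqP; rewrite eq_le le_max_out ?agree_upd //= same // Vc Vb.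
rewrite -(same b c) ?rb //.
exact: le_max_out (agree_upd _ _).
Qed.

Lemma value_from_optimal k a : (k <= ndec G)%N ->
  value_from optimal k a = dp_from k a.
Proof.
move=> kn; elim/ord_down_ind: k / kn a => [a|i IH a].
  exact: value_from_last.
rewrite value_from_step dp_from_step; apply: eq_sum_out => b.
(* The required constancy of [dp_from i.+1] comes from the induction hypothesis: it equals
   [value_from], a sum over the pending variables. *)
rewrite IH optimal_max // => c c' cc'; rewrite -!IH.
exact: sum_out_const.
Qed.

Lemma dpfun_optimal : dpfun w = Pr optimal w.
Proof. by rewrite dp_from0 (value_from0 _ (dflt G)) value_from_optimal. Qed.

Lemma Pr_le_dpfun s : Pr s w <= dpfun w.
Proof. by rewrite dp_from0 (value_from0 _ (dflt G)) value_from_le. Qed.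

End DynamicProgramming.

(** * Maximal expected utility with perfect information *)

Theorem theorem4 (R : realFieldType) (G : diagram R) (e : evidence G)
    (X : chance G) (D : circuit G) (s0 : strategy G)
    (he_U : e None = None)
    (he_unaffected : forall Y : uvar G, e Y <> None -> ~~ affected Y)
    (he_pos : 0 < Pr s0 e)
    (hX_unobserved : e (Some X) = None)
    (hX_unaffected : ~~ affected (Some X : uvar G))
    (hD : decision_circuit D) :
  MEU_PI s0 e X =
    (Pr s0 e)^-1 *
    \sum_(x : udom (Some X : uvar G))
       root_value D
         (extend (extend e (true : udom (None : uvar G))) x).
Proof.
rewrite /MEU_PI mulr_sumr; apply: eq_bigr => x _.
set ex := extend e x; set w := extend _ x; set u : udom (None : uvar G) := true.
have w_ex s : Pr s (extend ex u) = Pr s w by apply/eq_Pr/extendC.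
have Pr_ex s : Pr s ex = Pr s0 ex.
  apply: Pr_unaffected => Y; have [->|YX] := eqVneq Y (Some X) => //.
  by rewrite /ex extend_out //; apply: he_unaffected.
have Pr_w_le s : Pr s w <= Pr s0 ex.
  by rewrite -w_ex -(Pr_ex s) le_Pr_extend // /ex extend_out.
(* All conditional probabilities share the denominator [Pr s0 ex], so the strategy maximizing the
   joint probability of [w] also maximizes them. *)
rewrite (@bigmaxr_attained _ _ _ _ (optimal w)) ?mem_enum //; first last.
- move=> s _; rewrite /condPr !w_ex !Pr_ex ler_wpM2r ?invr_ge0 ?Pr_ge0 //.
  by rewrite -dpfun_optimal Pr_le_dpfun.
- by rewrite divr_ge0 ?Pr_ge0.
rewrite hD dpfun_optimal /condPr w_ex Pr_ex -/ex.
have [ex0|ex_neq0] := eqVneq (Pr s0 ex) 0; last first.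
  by rewrite mulrAC mulrCA divff // mulr1 mulrC.
(* When [x] is impossible given [e], the larger event [ex] has probability 0, and by [Pr_w_le] so
   has [w]. *)
have -> : Pr (optimal w) w = 0.
  by apply/eqP; rewrite eq_le Pr_ge0 andbT -ex0.
by rewrite mul0r !mulr0.
Qed.
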